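(* Let $T>0$, $W\in C^1([0,T),\mathbb R^{d\times s})$ with $\mathrm{rank}(W(t))=s$ for all $t\in[0,T)$, and let $V(t)=\mathrm{range}(W(t))\in\mathcal G(s,d)$. Then for every $\tau\in[0,T)$ the function $t\mapsto\angle(V(\tau),V(t))$ is differentiable from the right at $t=\tau$, and $$\frac{d}{dt}\angle(V(\tau),V(t))\Big|_{t=\tau+}=\Big\|(I_d-P_{V(\tau)})\,\frac{dW}{dt}(\tau)\,\big(W(\tau)^\top W(\tau)\big)^{-1/2}\Big\|,$$ where $\|\cdot\|$ is the spectral norm on $\mathbb R^{d\times s}$ and $P_{V(\tau)}$ is the orthogonal projection onto $V(\tau)$.
   Context: $\mathcal G(s,d)$ is the Grassmannian of $s$-dimensional subspaces of $\mathbb R^d$. For $V,W\in\mathcal G(s,d)$ choose $P,Q\in\mathbb R^{d\times s}$ with orthonormal columns spanning $V$ and $W$; the principal angles $0\le\phi_1\le\dots\le\phi_s\le\pi/2$ are defined by $\cos\phi_j=\sigma_j$ where $\sigma_1\ge\dots\ge\sigma_s\ge0$ are the singular values of $P^\top Q$, and $\angle(V,W):=\phi_s$ is the maximal principal angle. $(W^\top W)^{-1/2}$ denotes the inverse of the symmetric positive definite square root. *)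

(* Defs.v *)
From HB Require Import structures.
From mathcomp Require Import all_boot all_order all_algebra.
From mathcomp Require Import all_classical all_reals all_analysis.
Set Implicit Arguments. Unset Strict Implicit. Unset Printing Implicit Defensive.
Import Order.TTheory GRing.Theory Num.Theory numFieldNormedType.Exports.
Local Open Scope classical_set_scope.
Local Open Scope ring_scope.

(* Subspaces of R^d are encoded, as in mxalgebra, by the row space of a
   d x d matrix.  The range (column space) of W : 'M_(d,s) is the row space
   of W^T. *)
Definition mxrange (R : realType) (d s : nat) (W : 'M[R]_(d, s)) : 'M[R]_d :=
  <<W^T>>%MS.

Definition col_norm (R : realType) (n : nat) (x : 'cV[R]_n) : R :=
  Num.sqrt (\sum_i (x i 0) ^+ 2).

Definition spec_norm (R : realType) (m n : nat) (A : 'M[R]_(m, n)) : R :=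
  sup [set col_norm (A *m x) | x in [set x : 'cV[R]_n | col_norm x = 1]].

Definition is_onb (R : realType) (d s : nat) (U : 'M[R]_d) (P : 'M[R]_(d, s)) :=
  P^T *m P = 1%:M /\ (P^T == U)%MS.

Definition onb (R : realType) (d s : nat) (U : 'M[R]_d) : 'M[R]_(d, s) :=
  xget 0 [set P | is_onb U P].

Definition min_sing_val (R : realType) (s : nat) (M : 'M[R]_s) : R :=
  Num.sqrt (inf [set a : R | eigenvalue (M^T *m M) a]).

(* maximal principal angle between two s-dimensional subspaces of R^d:
   phi_s with cos phi_s = sigma_s(P^T Q), phi_s in [0, pi/2]. *)
Definition max_angle (R : realType) (d s : nat) (V W : 'M[R]_d) : R :=
  acos (min_sing_val ((onb s V)^T *m (onb s W))).

Definition orth_proj (R : realType) (d : nat) (U : 'M[R]_d) : 'M[R]_d :=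
  xget 0 [set Pi : 'M[R]_d | Pi^T = Pi /\ Pi *m Pi = Pi /\ (Pi == U)%MS].

Definition sqrtm (R : realType) (n : nat) (A : 'M[R]_n) : 'M[R]_n :=
  xget 0 [set S : 'M[R]_n | S^T = S
      /\ (forall x : 'cV[R]_n, x != 0 -> 0 < (x^T *m S *m x) 0 0)
      /\ S *m S = A].

(* Main.v *)
(* If the principal angle between range V and range W is th, and G projects onto
   the orthogonal complement of range V, then Pythagoras turns the extremal
   characterisation of the smallest singular value into
     sin th = max { |G W y| : |W y| = 1 }.
   For V = W(tau) and W = W(tau + h) we have G V = 0, hence
   G W = h G D with D = (W(tau + h) - W(tau)) / h.  Substituting y = K z with
   K = (V^T V)^(-1/2), an isometry z |-> V K z, gives
     sin th / h = max |G D K z| / |W(tau + h) K z|,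
   where numerator and denominator are uniformly close to |G W'(tau) K z| and |z|.
   So sin th / h tends to the spectral norm of G W'(tau) K, and th / h has the
   same limit because asin'(0) = 1. *)
Require Import Defs.
From HB Require Import structures.
From mathcomp Require Import all_boot all_order all_algebra.
From mathcomp Require Import all_classical all_reals all_analysis.
From mathcomp Require Import ring lra.
Import Order.TTheory GRing.Theory Num.Theory numFieldNormedType.Exports.
Local Open Scope classical_set_scope.
Local Open Scope ring_scope.

(** * Euclidean inner product and norm on column vectors *)

Definition dot {R : realType} {n : nat} (u v : 'cV[R]_n) : R := (u^T *m v) 0 0.

Lemma dotE {R : realType} {n} (u v : 'cV[R]_n) : dot u v = \sum_i u i 0 * v i 0.
Proof. by rewrite /dot mxE; apply: eq_bigr => i _; rewrite mxE. Qed.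

Lemma dotC {R : realType} {n} (u v : 'cV[R]_n) : dot u v = dot v u.
Proof. by rewrite !dotE; apply: eq_bigr => i _; rewrite mulrC. Qed.

Lemma dotDr {R : realType} {n} (u v w : 'cV[R]_n) :
  dot u (v + w) = dot u v + dot u w.
Proof. by rewrite /dot mulmxDr mxE. Qed.

Lemma dotDl {R : realType} {n} (u v w : 'cV[R]_n) :
  dot (v + w) u = dot v u + dot w u.
Proof. by rewrite dotC dotDr !(dotC u). Qed.

Lemma dotZr {R : realType} {n} (u v : 'cV[R]_n) a : dot u (a *: v) = a * dot u v.
Proof. by rewrite /dot -scalemxAr mxE. Qed.

Lemma dotZl {R : realType} {n} (u v : 'cV[R]_n) a : dot (a *: u) v = a * dot u v.
Proof. by rewrite dotC dotZr dotC. Qed.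

Lemma dotNr {R : realType} {n} (u v : 'cV[R]_n) : dot u (- v) = - dot u v.
Proof. by rewrite /dot mulmxN mxE. Qed.

Lemma dotNl {R : realType} {n} (u v : 'cV[R]_n) : dot (- u) v = - dot u v.
Proof. by rewrite dotC dotNr dotC. Qed.

Lemma dot_mulmxl {R : realType} {m n} (A : 'M[R]_(m, n)) u v :
  dot (A *m u) v = dot u (A^T *m v).
Proof. by rewrite /dot trmx_mul mulmxA. Qed.

Lemma dot_mulmxr {R : realType} {m n} (A : 'M[R]_(m, n)) u v :
  dot v (A *m u) = dot (A^T *m v) u.
Proof. by rewrite dotC dot_mulmxl dotC. Qed.

Lemma dot_ge0 {R : realType} {n} (u : 'cV[R]_n) : 0 <= dot u u.
Proof. by rewrite dotE sumr_ge0 // => i _; rewrite -expr2 sqr_ge0. Qed.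

Lemma dot_eq0 {R : realType} {n} (u : 'cV[R]_n) : (dot u u == 0) = (u == 0).
Proof.
apply/idP/eqP => [|->]; last by rewrite /dot mulmx0 mxE.
rewrite dotE psumr_eq0 => [/allP u0|i _]; last by rewrite -expr2 sqr_ge0.
apply/colP => i; rewrite mxE; apply/eqP.
by have := u0 i (mem_index_enum i); rewrite /= mulf_eq0 orbb.
Qed.

Lemma dot_gt0 {R : realType} {n} (u : 'cV[R]_n) : (0 < dot u u) = (u != 0).
Proof. by rewrite lt_neqAle dot_ge0 andbT eq_sym dot_eq0. Qed.

Lemma col_normE {R : realType} {n} (u : 'cV[R]_n) :
  col_norm u = Num.sqrt (dot u u).
Proof. by rewrite dotE. Qed.

Lemma col_norm_ge0 {R : realType} {n} (u : 'cV[R]_n) : 0 <= col_norm u.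
Proof. exact: sqrtr_ge0. Qed.

Lemma sqr_col_norm {R : realType} {n} (u : 'cV[R]_n) : col_norm u ^+ 2 = dot u u.
Proof. by rewrite col_normE sqr_sqrtr ?dot_ge0. Qed.

Lemma col_norm_eq1 {R : realType} {n} (u : 'cV[R]_n) :
  col_norm u = 1 <-> dot u u = 1.
Proof.
by split=> [u1|u1]; rewrite -?sqr_col_norm ?u1 ?expr1n // col_normE u1 sqrtr1.
Qed.

Lemma col_norm_eq0 {R : realType} {n} (u : 'cV[R]_n) : (col_norm u == 0) = (u == 0).
Proof. by rewrite -sqrf_eq0 sqr_col_norm dot_eq0. Qed.

Lemma col_normZ {R : realType} {n} a (u : 'cV[R]_n) :
  col_norm (a *: u) = `|a| * col_norm u.
Proof.
by rewrite !col_normE dotZl dotZr mulrA -expr2 sqrtrM ?sqr_ge0 // sqrtr_sqr.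
Qed.

Lemma col_normN {R : realType} {n} (u : 'cV[R]_n) : col_norm (- u) = col_norm u.
Proof. by rewrite !col_normE dotNl dotNr opprK. Qed.

Lemma col_normalize {R : realType} {n} (u : 'cV[R]_n) :
  u != 0 -> col_norm ((col_norm u)^-1 *: u) = 1.
Proof.
rewrite -col_norm_eq0 => u0.
by rewrite col_normZ normfV ger0_norm ?col_norm_ge0 // mulVf.
Qed.

(** Cauchy-Schwarz: with a = u.u, b = u.v and c = v.v, the squared length of a v - b u is a (a c -
    b^2). *)
Lemma dot_sqr_le {R : realType} {n} (u v : 'cV[R]_n) :
  dot u v ^+ 2 <= dot u u * dot v v.
Proof.
have [->|u0] := eqVneq u 0.
  by rewrite /dot !trmx0 !mul0mx !mxE expr0n mul0r.
rewrite -dot_gt0 in u0.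
have := dot_ge0 (dot u u *: v - dot u v *: u).
rewrite !(dotDl, dotDr, dotNl, dotNr, dotZl, dotZr) (dotC v u).
set a := dot u u in u0 *; set b := dot u v; set c := dot v v => h.
have : 0 <= a * (a * c - b ^+ 2) by apply: (le_trans h); nra.
by rewrite pmulr_rge0 // subr_ge0.
Qed.

Lemma ler_col_normD {R : realType} {n} (u v : 'cV[R]_n) :
  col_norm (u + v) <= col_norm u + col_norm v.
Proof.
rewrite -(@ler_pXn2r _ 2) ?nnegrE ?addr_ge0 ?col_norm_ge0 //.
rewrite sqrrD !sqr_col_norm dotDl !dotDr (dotC v u).
suff : dot u v <= col_norm u * col_norm v by nra.
apply: le_trans (ler_norm _) _.
rewrite -(@ler_pXn2r _ 2) ?nnegrE ?mulr_ge0 ?col_norm_ge0 //.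
by rewrite real_normK ?num_real // exprMn !sqr_col_norm dot_sqr_le.
Qed.

(** The Frobenius norm, a bound for the operator norm that tends to 0 as soon as all entries do. *)
Definition frob {R : realType} {m n : nat} (A : 'M[R]_(m, n)) : R :=
  Num.sqrt (\sum_i \sum_j A i j ^+ 2).

Lemma col_norm_mulmx_frob {R : realType} {m n} (A : 'M[R]_(m, n)) x :
  col_norm (A *m x) <= frob A * col_norm x.
Proof.
rewrite -(@ler_pXn2r _ 2) ?nnegrE ?mulr_ge0 ?col_norm_ge0 ?sqrtr_ge0 //.
rewrite exprMn !sqr_col_norm sqr_sqrtr; last first.
  by do 2 (apply: sumr_ge0 => ? _); rewrite sqr_ge0.
rewrite [leLHS]dotE mulr_suml ler_sum // => i _.
have := dot_sqr_le (row i A)^T x.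
have -> : dot (row i A)^T x = (A *m x) i 0 by rewrite /dot trmxK -row_mul !mxE.
rewrite -expr2 => /le_trans; apply; rewrite ler_wpM2r ?dot_ge0 // dotE.
by apply: ler_sum => j _; rewrite !mxE expr2.
Qed.

(** * Quadratic forms on the unit sphere *)

Lemma cvg_sumr {R : realType} {I : finType} {T : Type} {F : set_system T}
    {FF : Filter F} (f : I -> T -> R) (l : I -> R) :
  (forall i, f i x @[x --> F] --> l i) ->
  \sum_i f i x @[x --> F] --> \sum_i l i.
Proof.
by move=> fl; apply: (cvg_big (@add_continuous R)) => i _; exact: fl.
Qed.

(* The topology of MathComp-Analysis only makes row vectors compact, whence the
   transpositions. *)
Lemma dot_mulmx_max {R : realType} {n} (A : 'M[R]_n) : (0 < n)%N ->
  exists2 c : 'cV[R]_n, col_norm c = 1 &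
    forall t, col_norm t = 1 -> dot t (A *m t) <= dot c (A *m c).
Proof.
move=> n0; pose f B (x : 'rV[R]_n) : R := dot x^T (B *m x^T).
have fcont B : continuous (f B).
  have -> : f B = fun x => \sum_i x 0 i * (\sum_j B i j * x 0 j).
    apply/funext => x; rewrite /f dotE; apply: eq_bigr => i _.
    by rewrite !mxE; congr (_ * _); apply: eq_bigr => j _; rewrite mxE.
  move=> x; apply: (cvg_sumr (FF := nbhs_filter x)) => i.
  apply: cvgM; first exact: coord_continuous.
  apply: (cvg_sumr (FF := nbhs_filter x)) => j.
  by apply: cvgMr; exact: coord_continuous.
pose S := [set x : 'rV[R]_n | col_norm x^T = 1].
(* [f 1%:M] is the squared length, so the sphere is a closed level set. *)
have SE : S = f 1%:M @^-1` [set 1].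
  by apply/seteqP; split=> x; rewrite /S /f /= mul1mx => /col_norm_eq1.
have cS : compact S.
  apply: bounded_closed_compact; last first.
    by rewrite SE; apply: preimage_closed => [? _|]; [exact: fcont|exact: closed_eq].
  exists 1; split=> // M M1 x Sx.

  (* The norm of [x] here is the maximum of the absolute entries, each at most the Euclidean norm
     1. *)
  rewrite /= -[`|x|]/(mx_norm x) mx_normrE; apply: bigmax_le => [|[i j] _ /=].
    exact: le_trans (ltW M1).
  apply: le_trans (ltW M1); rewrite (ord1 i) -(@ler_pXn2r _ 2) ?nnegrE //.
  have /col_norm_eq1 x1 : col_norm x^T = 1 by [].
  rewrite expr1n -x1 real_normK ?num_real // dotE (bigD1 j) //= !mxE expr2 lerDl.
  by apply: sumr_ge0 => k _; rewrite -expr2 sqr_ge0.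
have S0 : S !=set0.
  have i0 : 'I_n by exists 0%N.
  pose e : 'cV[R]_n := delta_mx i0 0.
  exists ((col_norm e)^-1 *: e)^T; rewrite /S /= trmxK; apply: col_normalize.
  by apply/eqP => /matrixP /(_ i0 0); rewrite !mxE !eqxx => /eqP; rewrite oner_eq0.
have [c] := EVT_max_rV S0 cS (continuous_subspaceT (fcont A)).
rewrite inE => Sc fc; exists c^T => // t t1.
by have := fc t^T; rewrite inE /S /f /= !trmxK; exact.
Qed.

Lemma ler_form_unit {R : realType} {n} (A : 'M[R]_n) a :
    (forall t, col_norm t = 1 -> dot t (A *m t) <= a) ->
  forall x, dot x (A *m x) <= a * dot x x.
Proof.
move=> Aa x; have [->|x0] := eqVneq x 0; first by rewrite /dot !mulmx0 mxE mulr0.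
have := Aa _ (col_normalize x x0).
rewrite -scalemxAr dotZl dotZr mulrA -expr2 exprVn sqr_col_norm.
by rewrite mulrC ler_pdivrMr ?dot_gt0.
Qed.

(** * Positive semidefinite matrices and their square roots *)

(** With w = S x, a = w.w and q = w.Sw, the form at (q + 1) x - a w equals - a^2 (q + 2); being
    nonnegative, it forces a = 0. *)
Lemma psd_ker {R : realType} {n} (S : 'M[R]_n) x :
    S^T = S -> (forall y, 0 <= dot y (S *m y)) ->
  dot x (S *m x) = 0 -> S *m x = 0.
Proof.
move=> Ssym S0 Sx0; apply/eqP; rewrite -dot_eq0.
set w := S *m x in Sx0 *; set q := dot w (S *m w); set a := dot w w.
have := S0 ((q + 1) *: x - a *: w).
rewrite mulmxBr -!scalemxAr -/w !(dotDl, dotDr, dotNl, dotNr, dotZl, dotZr).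
have -> : dot x (S *m w) = a by rewrite dot_mulmxr Ssym.
rewrite Sx0 -/q -/a => h.
have q0 : 0 <= q by exact: S0.
have : a ^+ 2 * (q + 2) <= 0 by nra.
by rewrite pmulr_lle0 ?ltr_wpDl // => a0; rewrite -sqrf_eq0 eq_le a0 sqr_ge0.
Qed.

Lemma mulmx_outer {R : realType} {n} (u x : 'cV[R]_n) :
  (u *m u^T) *m x = dot u x *: u.
Proof. by rewrite -mulmxA [u^T *m x]mx11_scalar mul_mx_scalar. Qed.

Lemma mulmx_eq0P {R : realType} {m n} (A : 'M[R]_(m, n)) :
  (forall x : 'cV[R]_n, A *m x = 0) -> A = 0.
Proof.
move=> A0; apply/matrixP => i j.
by have /colP /(_ i) := A0 (delta_mx j 0); rewrite -colE !mxE.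
Qed.

(* Deflation: if u is a unit maximiser of x^T A x, with maximum l, then
   A u = l u and A - l u u^T is again positive semidefinite, of smaller rank;
   adding (sqrt l) u u^T to its square root gives one of A. *)
Lemma psd_sqrt_exists {R : realType} {n} (A : 'M[R]_n) :
    A^T = A -> (forall x, 0 <= dot x (A *m x)) ->
  exists S : 'M[R]_n,
    [/\ S^T = S, (forall x, 0 <= dot x (S *m x)) & S *m S = A].
Proof.
have [r] := ubnP (\rank A); elim: r A => // r IHr A; rewrite ltnS => rA Asym A0.
have [->|An0] := eqVneq A 0.
  by exists 0; split=> [|x|]; rewrite ?trmx0 ?mulmx0 // /dot mul0mx mulmx0 mxE.
have n0 : (0 < n)%N.
  by case: n {IHr rA Asym A0} A An0 => // A; rewrite flatmx0 eqxx.
have [u u1 umax] := dot_mulmx_max A n0.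
have Amax := ler_form_unit _ _ umax.
move/col_norm_eq1: u1 => u1; set l := dot u (A *m u) in Amax.
have l_ge0 : 0 <= l by exact: A0.
(* The matrix l I - A is positive semidefinite and its form vanishes at u, so [psd_ker] applies. *)
have Au : A *m u = l *: u.
  apply/eqP; rewrite eq_sym -subr_eq0 -mul_scalar_mx -mulmxBl; apply/eqP.
  apply: psd_ker => [|y|].
  - by rewrite linearB /= tr_scalar_mx Asym.
  - by rewrite mulmxBl mul_scalar_mx dotDr dotNr dotZr subr_ge0.
  - by rewrite mulmxBl mul_scalar_mx dotDr dotNr dotZr u1 mulr1 subrr.
have uA x : dot u (A *m x) = l * dot u x by rewrite dot_mulmxr Asym Au dotZl.
have l_neq0 : l != 0.
  apply: contra_neq An0 => l0; apply: mulmx_eq0P => x; apply: psd_ker => //.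
  by apply/eqP; rewrite eq_le A0 andbT (le_trans (Amax x)) // l0 mul0r.
pose B := A - l *: (u *m u^T).
have BE x : B *m x = A *m x - (l * dot u x) *: u.
  by rewrite mulmxBl -scalemxAl mulmx_outer scalerA.
have Bu : B *m u = 0 by rewrite BE Au u1 mulr1 subrr.
have BA : B = (1%:M - u *m u^T) *m A.
  rewrite mulmxBl mul1mx -mulmxA; congr (_ - _).
  by rewrite -[in RHS]Asym -trmx_mul Au linearZ -scalemxAr.
have uusym : (u *m u^T)^T = u *m u^T by rewrite trmx_mul trmxK.
have Bsym : B^T = B by rewrite linearB linearZ /= Asym uusym.
have B0 x : 0 <= dot x (B *m x).
  have := A0 (x - dot u x *: u).
  rewrite mulmxBr -scalemxAr Au BE !(dotDl, dotDr, dotNl, dotNr, dotZl, dotZr).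
  by rewrite uA u1 (dotC x u) => h; apply: le_trans h _; lra.
(* The row space of B lies in that of A, and strictly: A = X B would give l u = A u = X B u = 0. *)
have rB : (\rank B < r)%N.
  apply: leq_trans rA; apply: rank_ltmx; rewrite /ltmx BA submxMl -BA /=.
  apply/negP => /submxP[X AX]; move: Au; rewrite AX -mulmxA Bu mulmx0 => /esym/eqP.
  by rewrite scaler_eq0 (negPf l_neq0) -dot_eq0 u1 oner_eq0.
have [S [Ssym S0 SS]] := IHr B rB Bsym B0.
(* |S u|^2 = u.Bu = 0, which removes the cross terms when the new root is squared. *)
have Su : S *m u = 0.
  by apply/eqP; rewrite -dot_eq0 dot_mulmxl Ssym mulmxA SS Bu /dot mulmx0 mxE.
exists (S + Num.sqrt l *: (u *m u^T)); split=> [|x|].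
- by rewrite linearD linearZ /= Ssym uusym.
- rewrite mulmxDl -scalemxAl mulmx_outer dotDr !dotZr (dotC x u) addr_ge0 //.
  by rewrite mulr_ge0 ?sqrtr_ge0 // -expr2 sqr_ge0.
- rewrite mulmxDl !mulmxDr SS -!scalemxAl -!scalemxAr scalerA -expr2 sqr_sqrtr //.
  rewrite mulmxA Su mul0mx scaler0 addr0 -[u *m u^T *m S]mulmxA.
  rewrite -[u^T *m S]trmxK trmx_mul trmxK Ssym Su trmx0 mulmx0 scaler0 add0r.
  rewrite mulmxA -[u *m u^T *m u]mulmxA [u^T *m u]mx11_scalar -/(dot u u) u1.
  by rewrite mulmx1 subrK.
Qed.

Lemma unitmx_ker0 {R : realType} {n} (A : 'M[R]_n) :
  (forall x : 'cV[R]_n, A *m x = 0 -> x = 0) -> A \in unitmx.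
Proof.
move=> A0; rewrite -unitmx_tr -row_free_unit -kermx_eq0; apply/eqP/row_matrixP => i.
rewrite row0 -[LHS]trmxK -[RHS]trmxK trmx0; congr trmx; apply: A0; apply: trmx_inj.
by rewrite trmx_mul trmxK -row_mul mulmx_ker row0 trmx0.
Qed.

Lemma sqrtm_pd {R : realType} {n} (A : 'M[R]_n) :
    A^T = A -> (forall x, x != 0 -> 0 < dot x (A *m x)) ->
  [/\ (sqrtm A)^T = sqrtm A, sqrtm A *m sqrtm A = A & sqrtm A \in unitmx].
Proof.
move=> Asym A0.
have [x|S [Ssym S0 SS]] := psd_sqrt_exists A Asym.
  by have [->|/A0/ltW //] := eqVneq x 0; rewrite /dot !mulmx0 mxE.
have : (exists S, [set S : 'M[R]_n | S^T = S
      /\ (forall x : 'cV[R]_n, x != 0 -> 0 < (x^T *m S *m x) 0 0)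
      /\ S *m S = A] S).
  (* The semidefinite root is definite: x.Sx = 0 would give S x = 0, hence x.Ax = 0. *)
  exists S; split=> //; split=> // x x0; rewrite -mulmxA -/(dot x _) lt_neqAle S0 andbT.
  apply/eqP => /esym /(psd_ker _ _ Ssym S0) Sx0; have := A0 x x0.
  by rewrite -SS -mulmxA Sx0 /dot !mulmx0 mxE ltxx.
(* Since a root exists, the choice behind [sqrtm] meets its specification instead of falling back on
   the default 0. *)
move/(xgetPex 0); rewrite -/(sqrtm A) => -[Tsym [T0 TT]]; split=> //.
apply: unitmx_ker0 => x Tx0; have [-> //|/T0] := eqVneq x 0.
by rewrite -mulmxA Tx0 mulmx0 mxE ltxx.
Qed.

(** * Smallest singular value and spectral norm as attained extrema *)

(** A unit minimiser c of |M x|^2 is an eigenvector of M^T M; its eigenvalue m bounds all others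
    from below, so m is the infimum in [min_sing_val]. *)
Lemma min_sing_valP {R : realType} {s} (M : 'M[R]_s) : (0 < s)%N ->
  [/\ forall x, min_sing_val M * col_norm x <= col_norm (M *m x)
    & exists2 x, col_norm x = 1 & col_norm (M *m x) = min_sing_val M].
Proof.
move=> s0; pose A := M^T *m M.
have Asym : A^T = A by rewrite trmx_mul trmxK.
have AE x : dot x (A *m x) = dot (M *m x) (M *m x) by rewrite dot_mulmxl mulmxA.
have [c c1 cmax] := dot_mulmx_max (- A) s0.
set m := dot (M *m c) (M *m c).
have Amin x : m * dot x x <= dot x (A *m x).
  have := ler_form_unit _ _ cmax x.
  by rewrite !mulNmx !dotNr !AE -/m mulNr lerN2.
have cc : dot c c = 1 by apply/col_norm_eq1.
have Ac : A *m c = m *: c.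
  apply/eqP; rewrite -subr_eq0 -mul_scalar_mx -mulmxBl; apply/eqP.
  apply: psd_ker => [|y|].
  - by rewrite linearB /= tr_scalar_mx Asym.
  - by rewrite mulmxBl mul_scalar_mx dotDr dotNr dotZr subr_ge0.
  - by rewrite mulmxBl mul_scalar_mx dotDr dotNr dotZr cc mulr1 AE subrr.
(* [eigenvalue] refers to row vectors; the symmetry of A turns them into columns. *)
have lb : lbound [set a : R | eigenvalue A a] m.
  move=> a /eigenvalueP[v vA v0].
  have v0' : 0 < dot v^T v^T by rewrite dot_gt0 -(inj_eq trmx_inj) trmxK trmx0.
  rewrite -(ler_pM2r v0') (le_trans (Amin _)) // -[A]Asym -trmx_mul vA.
  by rewrite linearZ /= dotZr.
have em : eigenvalue A m.
  apply/eigenvalueP; exists c^T.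
    by rewrite -[A]Asym -trmx_mul Ac linearZ.
  by rewrite -(inj_eq trmx_inj) trmxK trmx0 -dot_gt0 cc.
have infE : inf [set a : R | eigenvalue A a] = m.
  apply/eqP; rewrite eq_le ge_inf //=; last by exists m.
  by apply: lb_le_inf => //; exists m.
have -> : min_sing_val M = col_norm (M *m c) by rewrite /min_sing_val infE col_normE.
split=> [x|]; last by exists c.
rewrite -(@ler_pXn2r _ 2) ?nnegrE ?mulr_ge0 ?col_norm_ge0 //.
by rewrite exprMn !sqr_col_norm -(AE x).
Qed.

(** Maximising the form of B^T B on the unit sphere maximises |B x|, so the supremum is attained. *)
Lemma spec_normP {R : realType} {m n} (B : 'M[R]_(m, n)) : (0 < n)%N ->
  (forall x, col_norm (B *m x) <= spec_norm B * col_norm x) /\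
  (exists2 x, col_norm x = 1 & col_norm (B *m x) = spec_norm B).
Proof.
move=> n0; have [c c1 cmax] := dot_mulmx_max (B^T *m B) n0.
have AE x : dot x (B^T *m B *m x) = dot (B *m x) (B *m x).
  by rewrite dot_mulmxl mulmxA.
have Bmax x : col_norm (B *m x) <= col_norm (B *m c) * col_norm x.
  rewrite -(@ler_pXn2r _ 2) ?nnegrE ?mulr_ge0 ?col_norm_ge0 //.
  by rewrite exprMn !sqr_col_norm -!AE; exact: ler_form_unit.
suff -> : spec_norm B = col_norm (B *m c) by split=> //; exists c.
have ub : ubound [set col_norm (B *m x) | x in [set x : 'cV[R]_n | col_norm x = 1]]
            (col_norm (B *m c)).
  by move=> _ [x /= x1 <-]; rewrite (le_trans (Bmax x)) // x1 mulr1.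
apply/eqP; rewrite eq_le; apply/andP; split.
  by apply: ge_sup => //; exists (col_norm (B *m c)), c.
by apply: ub_le_sup; [exists (col_norm (B *m c))|exists c].
Qed.

(** * Orthonormal bases and projections from a matrix of full column rank *)

Lemma mulmx_full_rank {R : realType} {d s} (W : 'M[R]_(d, s)) x :
  \rank W = s -> (W *m x == 0 :> 'cV_d) = (x == 0).
Proof.
move=> rW; rewrite -[LHS](inj_eq trmx_inj) trmx_mul trmx0 mulmx_free_eq0.
  by rewrite -[RHS](inj_eq trmx_inj) trmx0.
by rewrite /row_free mxrank_tr rW.
Qed.

(** Full column rank makes the Gram matrix positive definite, as its form at x is |W x|^2. *)
Lemma sqrtm_gram {R : realType} {d s} (W : 'M[R]_(d, s)) (S := sqrtm (W^T *m W)) :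
  \rank W = s -> [/\ S^T = S, S *m S = W^T *m W & S \in unitmx].
Proof.
move=> rW; apply: sqrtm_pd => [|x x0]; first by rewrite trmx_mul trmxK.
by rewrite -mulmxA -dot_mulmxl dot_gt0 mulmx_full_rank.
Qed.

Lemma gram_invmx_sqrtm {R : realType} {d s} (W : 'M[R]_(d, s))
    (K := invmx (sqrtm (W^T *m W))) :
  \rank W = s -> (W *m K)^T *m (W *m K) = 1%:M.
Proof.
move=> /sqrtm_gram [Ssym SS Su].
rewrite trmx_mul mulmxA -(mulmxA K^T) -SS trmx_inv Ssym mulmxA.
by rewrite mulVmx // mul1mx mulmxV.
Qed.

(** W (W^T W)^(-1/2) is an orthonormal basis of the range, so [onb] returns a genuine basis. *)
Lemma onbP {R : realType} {d s} (W : 'M[R]_(d, s)) (P := onb s (mxrange W)) :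
  \rank W = s -> P^T *m P = 1%:M /\ (P^T == W^T)%MS.
Proof.
move=> rW; have [_ _ Su] := sqrtm_gram W rW.
have : exists P, [set P : 'M[R]_(d, s) | is_onb (mxrange W) P] P.
  exists (W *m invmx (sqrtm (W^T *m W))); split; first exact: gram_invmx_sqrtm.
  rewrite trmx_mul /mxrange; apply/eqmxP.
  apply: (eqmx_trans (eqmxMfull _ _)); last exact/eqmx_sym/genmxE.
  by rewrite row_full_unit unitmx_tr unitmx_inv.
move/(xgetPex 0); rewrite -/(onb s (mxrange W)) -/P => -[PP PW]; split=> //.
by apply/eqmxP; apply: (eqmx_trans (eqmxP PW)); exact: genmxE.
Qed.

(** C and D translate between coordinates with respect to W and to the orthonormal basis. *)
Lemma onb_factor {R : realType} {d s} (W : 'M[R]_(d, s)) (P := onb s (mxrange W)) :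
  \rank W = s -> exists C D, P = W *m C /\ W = P *m D.
Proof.
move=> /onbP [_ /andP[/submxP[C PC] /submxP[D WD]]]; exists C^T, D^T.
by split; apply: trmx_inj; rewrite trmx_mul trmxK.
Qed.

(** Uniqueness of the projection: equality of ranges gives Pi = X P^T, and Pi P = P forces X = P. *)
Lemma orth_projE {R : realType} {d s} (W : 'M[R]_(d, s)) (P := onb s (mxrange W)) :
  \rank W = s -> orth_proj (mxrange W) = P *m P^T.
Proof.
move=> rW; have [PP /eqmxP PW] := onbP W rW; rewrite -/P in PP PW.
have WP : (mxrange W :=: P^T)%MS by apply: eqmx_trans (genmxE _) (eqmx_sym PW).
have : exists Pi, [set Pi : 'M[R]_d |
    Pi^T = Pi /\ Pi *m Pi = Pi /\ (Pi == mxrange W)%MS] Pi.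
  exists (P *m P^T); split; first by rewrite trmx_mul trmxK.
  split; first by rewrite mulmxA -(mulmxA P) PP mulmx1.
  rewrite !WP submxMl /=; apply/submxP; exists P^T.
  by rewrite mulmxA PP mul1mx.
move/(xgetPex 0); rewrite -/(orth_proj (mxrange W)).
set Pi := orth_proj _ => -[Pisym [PiPi]].
rewrite !WP => /andP[/submxP[X PiX] /submxP[Y PY]].
have PPi : P^T *m Pi = P^T by rewrite PY -mulmxA PiPi.
have {}PPi : Pi *m P = P by rewrite -[RHS]trmxK -PPi trmx_mul trmxK Pisym.
have XP : X = P by rewrite -PPi PiX -mulmxA PP mulmx1.
by rewrite PiX XP.
Qed.

Lemma orth_proj_compl_mul {R : realType} {d s} (W : 'M[R]_(d, s)) :
  \rank W = s -> (1%:M - orth_proj (mxrange W)) *m W = 0.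
Proof.
move=> rW; rewrite orth_projE //; have [PP _] := onbP W rW.
have [_ [D [_ WD]]] := onb_factor W rW.
set P := onb s (mxrange W) in PP WD *; rewrite [in LHS]WD.
by rewrite mulmxBl mul1mx !mulmxA -(mulmxA P) PP mulmx1 subrr.
Qed.

(** * The sine of the maximal angle *)

Lemma pythagoras_compl {R : realType} {d s} (P : 'M[R]_(d, s)) v :
  P^T *m P = 1%:M ->
  dot ((1%:M - P *m P^T) *m v) ((1%:M - P *m P^T) *m v)
    = dot v v - dot (P^T *m v) (P^T *m v).
Proof.
move=> PP; have PPv : P^T *m (P *m (P^T *m v)) = P^T *m v.
  by rewrite mulmxA PP mul1mx.
rewrite mulmxBl mul1mx -mulmxA !(dotDl, dotDr, dotNl, dotNr) [dot v (P *m _)]dot_mulmxr.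
by rewrite !dot_mulmxl PPv; lra.
Qed.

(** For the chosen bases P and Q, |G Q z|^2 = |z|^2 - |P^T Q z|^2, so the minimum sg of |P^T Q z|
    over unit z turns into the maximum sqrt (1 - sg^2) = sin th of |G Q z|. *)
Lemma max_angleP {R : realType} {d s} (V W : 'M[R]_(d, s))
    (th := max_angle s (mxrange V) (mxrange W))
    (G := 1%:M - orth_proj (mxrange V)) :
    (0 < s)%N -> \rank V = s -> \rank W = s ->
  [/\ 0 <= th <= pi / 2,
      forall y, col_norm (G *m (W *m y)) <= sin th * col_norm (W *m y)
    & exists2 y, col_norm (W *m y) = 1 & col_norm (G *m (W *m y)) = sin th].
Proof.
move=> s0 rV rW; rewrite /G orth_projE //; have [PP _] := onbP V rV.
have [QQ _] := onbP W rW; have [C [D [QC WD]]] := onb_factor W rW.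
rewrite {}/th {}/G /max_angle.
set P := onb s (mxrange V) in PP *; set Q := onb s (mxrange W) in QQ QC WD *.
have [Mmin [x x1 Mx]] := min_sing_valP (P^T *m Q) s0.
set sg := min_sing_val _ in Mmin Mx *.
have sg0 : 0 <= sg by rewrite -Mx col_norm_ge0.
have Qx z : dot (Q *m z) (Q *m z) = dot z z by rewrite dot_mulmxl mulmxA QQ mul1mx.
have Geq z : dot ((1%:M - P *m P^T) *m (Q *m z)) ((1%:M - P *m P^T) *m (Q *m z))
    = dot z z - col_norm (P^T *m Q *m z) ^+ 2.
  by rewrite pythagoras_compl // Qx sqr_col_norm -!mulmxA.
have xx : dot x x = 1 by apply/col_norm_eq1.
(* 1 - sg^2 is the squared length of the component of Q x orthogonal to the range of P. *)
have sg1 : sg <= 1.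
  rewrite -(@expr_le1 _ 2) // -subr_ge0 -xx -Mx -Geq; exact: dot_ge0.
have sgN : -1 <= sg <= 1 by rewrite sg1 andbT (le_trans _ sg0) // lerN10.
have sinE : sin (acos sg) = Num.sqrt (1 - sg ^+ 2) by rewrite sin_acos.
have sg21 : 0 <= 1 - sg ^+ 2 by rewrite subr_ge0 expr_le1.
rewrite sinE; split.
(* [acos] ranges up to pi; an angle beyond pi / 2 would have negative cosine, while sg >= 0. *)
- rewrite acos_ge0 //= leNgt; apply/negP => h.
  have : cos (acos sg) < cos (pi / 2).
    by rewrite ltr_cos // ?in_itv /= ?acos_ge0 ?acos_lepi //; have := pi_gt0 R; lra.
  by rewrite cos_pihalf acosK ?in_itv //= ltNge sg0.
- move=> y; rewrite {1 2}WD -(mulmxA Q) -(@ler_pXn2r _ 2) ?nnegrE ?mulr_ge0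
    ?col_norm_ge0 ?sqrtr_ge0 //.
  rewrite exprMn !sqr_col_norm Geq Qx [Num.sqrt (1 - _) ^+ 2]sqr_sqrtr // mulrBl.
  rewrite mul1r lerB //.
  rewrite -sqr_col_norm -exprMn ler_pXn2r ?nnegrE ?mulr_ge0 ?col_norm_ge0 //.
- have WC : W *m (C *m x) = Q *m x by rewrite mulmxA -QC.
  exists (C *m x); rewrite WC; first by apply/col_norm_eq1; rewrite Qx.
  by rewrite col_normE Geq xx Mx.
Qed.

Lemma asin0 {R : realType} : asin 0 = 0 :> R.
Proof. by rewrite -{1}sin0 sinK // in_itv /=; have := pi_gt0 R; lra. Qed.

(** Here G V = 0, so the sine is 0, and [asin] recovers an angle in [0, pi / 2] from its sine. *)
Lemma max_angle_id {R : realType} {d s} (V : 'M[R]_(d, s)) :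
  (0 < s)%N -> \rank V = s -> max_angle s (mxrange V) (mxrange V) = 0.
Proof.
move=> s0 rV; have [th _ [y _]] := max_angleP V V s0 rV rV.
rewrite mulmxA orth_proj_compl_mul // mul0mx => /eqP.
rewrite eq_sym (eqP (_ : col_norm 0 == 0)) ?col_norm_eq0 // => /eqP sinV.
have thI : max_angle s (mxrange V) (mxrange V) \in `[- (pi / 2), pi / 2].
  move: th; have := pi_gt0 R; rewrite in_itv /= => ? /andP[? ->].
  by rewrite andbT; lra.
by rewrite -(sinK thI) sinV asin0.
Qed.

(** Quantitative form of the limit: e bounds the operator G (h^-1 (W - V) - V') K and del bounds (W
    - V) K, so that |W K z| lies between (1 - del) |z| and (1 + del) |z|. *)
Lemma sin_max_angle_bounds {R : realType} {d s} (V W V' : 'M[R]_(d, s))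
    (K : 'M[R]_s) (h : R)
    (G := 1%:M - orth_proj (mxrange V)) (N := spec_norm (G *m V' *m K))
    (e := frob G * frob (h^-1 *: (W - V) - V') * frob K)
    (del := frob (W - V) * frob K) :
    (0 < s)%N -> \rank V = s -> \rank W = s ->
    K \in unitmx -> (V *m K)^T *m (V *m K) = 1%:M -> 0 < h -> del < 1 ->
  (N - e) / (1 + del) <= h^-1 * sin (max_angle s (mxrange V) (mxrange W))
    <= (N + e) / (1 - del).
Proof.
move=> s0 rV rW Ku VK h0 del1.
have [_ GW [y y1 Gy]] := max_angleP V W s0 rV rW; rewrite -/G in GW Gy.
set u := sin _ in GW Gy *.
have del0 : 0 <= del by rewrite mulr_ge0 ?sqrtr_ge0.
have hV0 : 0 < h^-1 by rewrite invr_gt0.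
have VKz z : col_norm (V *m K *m z) = col_norm z.
  by rewrite !col_normE dot_mulmxl mulmxA VK mul1mx.
have dK z : col_norm ((W - V) *m (K *m z)) <= del * col_norm z.
  apply: le_trans (col_norm_mulmx_frob _ _) _.
  by rewrite -mulrA ler_wpM2l ?sqrtr_ge0 // col_norm_mulmx_frob.
have WKz z : col_norm (W *m (K *m z)) <= (1 + del) * col_norm z.
  rewrite -[W](subrK V) mulmxDl addrC.
  apply: le_trans (ler_col_normD _ _) _.
  by rewrite mulmxA VKz mulrDl mul1r lerD2l.
have zWK z : (1 - del) * col_norm z <= col_norm (W *m (K *m z)).
  rewrite mulrBl mul1r lerBlDr -{1}VKz -mulmxA -[V in leLHS](subKr W).
  rewrite mulmxBl; apply: le_trans (ler_col_normD _ _) _.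
  by rewrite lerD2l col_normN.
(* G V = 0 makes V drop out of the difference quotient. *)
have GD z : G *m (h^-1 *: (W - V) *m (K *m z)) = h^-1 *: (G *m (W *m (K *m z))).
  by rewrite -scalemxAl -scalemxAr [(W - V) *m _]mulmxBl mulmxBr (mulmxA G V)
    orth_proj_compl_mul // mul0mx subr0.
pose E := h^-1 *: (W - V) - V'.
have GE z : col_norm (G *m (E *m (K *m z))) <= e * col_norm z.
  apply: le_trans (col_norm_mulmx_frob _ _) _.
  rewrite -!mulrA ler_wpM2l ?sqrtr_ge0 //.
  apply: le_trans (col_norm_mulmx_frob _ _) _.
  by rewrite ler_wpM2l ?sqrtr_ge0 // col_norm_mulmx_frob.
have GEE z : G *m (E *m (K *m z))
    = h^-1 *: (G *m (W *m (K *m z))) - G *m V' *m K *m z.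
  by rewrite [E *m _]mulmxBl mulmxBr GD !mulmxA.
have [Nmax [z z1 Nz]] := spec_normP (G *m V' *m K) s0; rewrite -/N in Nmax Nz.
apply/andP; split.
  (* Lower bound: test at a unit z attaining N = |G V' K z|. *)
  rewrite ler_pdivrMr ?ltr_wpDr // lerBlDr -Nz.
  have -> : G *m V' *m K *m z
      = h^-1 *: (G *m (W *m (K *m z))) + - (G *m (E *m (K *m z))).
    by rewrite GEE subKr.
  apply: le_trans (ler_col_normD _ _) _; apply: lerD; last first.
    by rewrite col_normN (le_trans (GE z)) // z1 mulr1.
  rewrite col_normZ gtr0_norm // -mulrA ler_pM2l //.
  apply: le_trans (GW _) _; rewrite ler_wpM2l -?Gy ?col_norm_ge0 //.
  by rewrite (le_trans (WKz z)) // z1 mulr1.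
(* Upper bound: test at x with K x = y, where y attains the sine; |W K x| = 1 then yields (1 - del)
   |x| <= 1. *)
pose x := invmx K *m y.
have Kx : K *m x = y by rewrite mulmxA mulmxV // mul1mx.
rewrite ler_pdivlMr ?subr_gt0 //.
have x1 : (1 - del) * col_norm x <= 1 by have := zWK x; rewrite Kx y1.
have e0 : 0 <= e by rewrite !mulr_ge0 ?sqrtr_ge0.
have N0 : 0 <= N by rewrite -Nz col_norm_ge0.
have ux : h^-1 * u <= (N + e) * col_norm x.
  rewrite -Gy -Kx -[h^-1]gtr0_norm // -col_normZ.
  have -> : h^-1 *: (G *m (W *m (K *m x)))
      = G *m V' *m K *m x + G *m (E *m (K *m x)) by rewrite GEE addrC subrK.
  by apply: le_trans (ler_col_normD _ _) _; rewrite mulrDl lerD.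
apply: le_trans (ler_wpM2r _ ux) _; first by rewrite subr_ge0 ltW.
by rewrite -mulrA -[leRHS]mulr1 ler_wpM2l ?addr_ge0 // mulrC.
Qed.

(** * Limits of matrices, of the arcsine quotient and along one-sided filters *)

Lemma frob_cvg0 {R : realType} {m n} {T : Type} {F : set_system T} {FF : Filter F}
    (A : T -> 'M[R]_(m, n)) :
  (forall i j, A x i j @[x --> F] --> 0) -> frob (A x) @[x --> F] --> 0.
Proof.
move=> A0; rewrite -[0 in X in _ --> X]sqrtr0.
suff AA : \sum_i \sum_j A x i j ^+ 2 @[x --> F] --> 0.
  exact: (cvg_comp _ _ AA (@sqrt_continuous R 0)).
have rowA i : \sum_j A x i j ^+ 2 @[x --> F] --> \sum_(j < n) (0 : R) ^+ 2.
  by apply: (cvg_sumr (FF := FF)) => j; apply: cvgM; exact: A0.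
have := cvg_sumr (FF := FF) _ _ rowA.
by rewrite big1 // => i _; rewrite big1 // => j _; rewrite expr0n.
Qed.

(* The value 1 at 0 makes asin u = asin_quot u * u hold at 0 as well, and
   asin_quot continuous there. *)
Definition asin_quot {R : realType} (u : R) : R := if u == 0 then 1 else asin u / u.

Lemma asin_quotE {R : realType} (u : R) : asin u = asin_quot u * u.
Proof.
rewrite /asin_quot; have [->|u0] := eqVneq u 0; first by rewrite asin0 mulr0.
by rewrite divfK.
Qed.

(** This is the derivative 1 of [asin] at 0. The value at 0 extends the limit from punctured to full
    neighbourhoods, so that it composes with a sine that may vanish for h > 0. *)
Lemma asin_quot_cvg {R : realType} : asin_quot u @[u --> (0 : R)] --> (1 : R).
Proof.
have d0 : is_derive (0 : R) 1 (@asin R) (Num.sqrt (1 - 0 ^+ 2))^-1.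
  by apply: is_derive1_asin; lra.
have l1 : 'D_1 (@asin R) 0 = 1.
  by rewrite (@derive_val _ _ _ _ _ _ _ d0) expr0n subr0 sqrtr1 invr1.
have dl : h^-1 *: ((asin \o shift 0) (h *: 1) - asin 0) @[h --> 0^'] --> (1 : R).
  by rewrite -[X in _ --> X]l1; exact: (@ex_derive _ _ _ _ _ _ _ d0).
apply/cvgrPdist_lt => eps eps0.
have dle : \forall u \near (0 : R), u != 0 ->
    `|1 - u^-1 *: ((asin \o shift 0) (u *: 1) - asin 0)| < eps.
  by move/cvgrPdist_lt : dl => /(_ _ eps0).
near=> u.
have [->|u0] := eqVneq u 0; first by rewrite /asin_quot eqxx subrr normr0.
have : `|1 - u^-1 *: ((asin \o shift 0) (u *: 1) - asin 0)| < eps.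
  by move: u0; near: u; exact: dle.
by rewrite /= addr0 asin0 subr0 scaler1 /asin_quot (negPf u0) [_ / _]mulrC.
Unshelve. all: by end_near.
Qed.

(** Near 0, h^-1 th is the product of [asin_quot] at sin th and h^-1 sin th; the first factor tends
    to 1 because sin th = h (h^-1 sin th) tends to 0. *)
Lemma slope_of_sin {R : realType} (th : R -> R) (N : R) :
    (\forall h \near 0^'+, 0 <= th h <= pi / 2) ->
    h^-1 * sin (th h) @[h --> 0^'+] --> N ->
  h^-1 * th h @[h --> 0^'+] --> N.
Proof.
move=> thb sN.
have id0 : h @[h --> (0 : R)^'+] --> (0 : R).
  by apply: cvg_at_right_filter; exact: cvg_id.
have sin0 : sin (th h) @[h --> 0^'+] --> 0.
  rewrite -[0 in X in _ --> X](mul0r N).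
  apply: cvg_trans (cvgM id0 sN); apply: near_eq_cvg; near=> h.
  by rewrite /= -[LHS]/(h * (h^-1 * sin (th h))) mulrA mulfV ?mul1r // gt_eqF.
have lim : asin_quot (sin (th h)) * (h^-1 * sin (th h)) @[h --> 0^'+] --> 1 * N.
  by apply: cvgM sN; exact: cvg_comp sin0 asin_quot_cvg.
rewrite mul1r in lim.
suff eqF : \forall h \near 0^'+,
    asin_quot (sin (th h)) * (h^-1 * sin (th h)) = h^-1 * th h.
  by apply: cvg_trans lim; apply: near_eq_cvg.
near=> h; have thE : asin (sin (th h)) = th h.
  rewrite sinK // in_itv /=; have /andP[? ->] : 0 <= th h <= pi / 2 by near: h.
  by rewrite andbT; have := pi_gt0 R; lra.
by rewrite mulrCA -asin_quotE thE.
Unshelve. all: by end_near.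
Qed.

(** Extracts the right derivative from differentiability on [0, T), which is two-sided in the
    interior and one-sided at 0. *)
Lemma cvg_within_at_right {R : realType} {U : topologicalType} (S : set R)
    (f : R -> U) (l : U) :
    (\forall h \near 0^'+, S h) -> f h @[h --> within S 0^'] --> l ->
  f h @[h --> 0^'+] --> l.
Proof.
move=> S0 fl P /fl fP.
have fP0 : \forall h \near (0 : R), h != 0 -> S h -> P (f h) := fP.
have fP1 : \forall h \near 0^'+, h != 0 -> S h -> P (f h) := cvg_within _ fP0.
suff fP2 : \forall h \near 0^'+, P (f h) by exact: fP2.
near=> h; have Sh : S h by near: h.
have h0 : h != 0 by rewrite gt_eqF.
by move: h0 Sh; near: h; exact: fP1.
Unshelve. all: by end_near.
Qed.

(** * The right derivative of the angle *)

Theorem theorem3p5 (R : realType) (d s : nat) (hs : (0 < s)%N)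
  (T : R) (hT : 0 < T) (W W' : R -> 'M[R]_(d, s))
  (hder : forall t, 0 <= t < T ->
     h^-1 *: (W (t + h) - W t) @[h --> within [set h | 0 <= t + h < T] 0^'] --> W' t)
  (hcont : {within `[0, T[, continuous W'})
  (hrank : forall t, 0 <= t < T -> \rank (W t) = s)
  (tau : R) (htau : 0 <= tau < T) :
  h^-1 * (max_angle s (mxrange (W tau)) (mxrange (W (tau + h)))
          - max_angle s (mxrange (W tau)) (mxrange (W tau))) @[h --> 0^'+]
  --> spec_norm ((1%:M - orth_proj (mxrange (W tau))) *m W' tau
                 *m invmx (sqrtm ((W tau)^T *m W tau))).
Proof.
set V := W tau; set V' := W' tau; set K := invmx _.
have rV : \rank V = s by exact: hrank.
have Ku : K \in unitmx by rewrite unitmx_inv; have [] := sqrtm_gram V rV.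
have /andP[tau0 tauT] := htau.
(* As tau < T, small h > 0 keep tau + h in [0, T), where the rank condition and the difference
   quotients are available. *)
have dom : \forall h \near 0^'+, 0 <= tau + h < T.
  near=> h; have h0 : 0 < h by [].
  have : h < T - tau by near: h; apply: nbhs_right_lt; rewrite subr_gt0.
  by move=> ?; apply/andP; split; lra.
pose D h := h^-1 *: (W (tau + h) - V).
have DV : D h @[h --> 0^'+] --> V'.
  exact: cvg_within_at_right dom (hder tau htau).
have Dij i j : D h i j @[h --> 0^'+] --> V' i j.
  exact: cvg_comp DV (@coord_continuous R d s i j V').
have id0 : h @[h --> (0 : R)^'+] --> (0 : R).
  by apply: cvg_at_right_filter; exact: cvg_id.
have e0 : frob (D h - V') @[h --> 0^'+] --> 0.
  apply: frob_cvg0 => i j.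
  have -> : (fun h => (D h - V') i j) = (fun h => D h i j - V' i j).
    by apply/funext => h; rewrite !mxE.
  have : D h i j - V' i j @[h --> 0^'+] --> V' i j - V' i j.
    by apply: cvgB (Dij i j) _; exact: cvg_cst.
  by rewrite subrr.
(* Right continuity of W at tau, from W (tau + h) - V = h D(h). *)
have d0 : frob (W (tau + h) - V) @[h --> 0^'+] --> 0.
  apply: frob_cvg0 => i j.
  have hD : h * D h i j @[h --> 0^'+] --> 0 * V' i j by exact: cvgM id0 (Dij i j).
  rewrite mul0r in hD.
  suff eqF : \forall h \near 0^'+, h * D h i j = (W (tau + h) - V) i j.
    exact: cvg_trans (near_eq_cvg eqF) hD.
  near=> h; by rewrite /D [in LHS]mxE mulrA mulfV ?mul1r // gt_eqF.
set G := 1%:M - _; set N := spec_norm _.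
pose e h := frob G * frob (D h - V') * frob K.
pose del h := frob (W (tau + h) - V) * frob K.
have {}e0 : e h @[h --> 0^'+] --> 0.
  have : e h @[h --> 0^'+] --> frob G * 0 * frob K by apply: cvgMl; apply: cvgMr.
  by rewrite mulr0 mul0r.
have {}d0 : del h @[h --> 0^'+] --> 0.
  have : del h @[h --> 0^'+] --> 0 * frob K by apply: cvgMl.
  by rewrite mul0r.
rewrite max_angle_id //.
have -> : (fun h => h^-1 * (max_angle s (mxrange V) (mxrange (W (tau + h))) - 0))
    = (fun h => h^-1 * max_angle s (mxrange V) (mxrange (W (tau + h)))).
  by apply/funext => h; rewrite subr0.
have rW : \forall h \near 0^'+, \rank (W (tau + h)) = s.
  by near=> h; apply: hrank; near: h.
apply: slope_of_sin.
  by near=> h; have [] := max_angleP V (W (tau + h)) hs rV (near rW h _).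
(* Both bounds tend to N because e and del tend to 0; they hold once del < 1, hence for all small h
   > 0. *)
apply: (squeeze_cvgr (f := fun h => (N - e h) / (1 + del h))
                     (h := fun h => (N + e h) / (1 - del h))).
- near=> h; apply: sin_max_angle_bounds => //.
  + by near: h.
  + exact: gram_invmx_sqrtm.
  + by near: h; apply: cvgr_lt d0 _ _.
- have : (N - e h) / (1 + del h) @[h --> 0^'+] --> (N - 0) / (1 + 0).
    apply: cvgM; first by apply: cvgB; [exact: cvg_cst|exact: e0].
    apply: cvgV; first by rewrite addr0 oner_eq0.
    by apply: cvgD; [exact: cvg_cst|exact: d0].
  by rewrite subr0 addr0 divr1.
- have : (N + e h) / (1 - del h) @[h --> 0^'+] --> (N + 0) / (1 - 0).
    apply: cvgM; first by apply: cvgD; [exact: cvg_cst|exact: e0].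
    apply: cvgV; first by rewrite subr0 oner_eq0.
    by apply: cvgB; [exact: cvg_cst|exact: d0].
  by rewrite subr0 addr0 divr1.
Unshelve. all: by end_near.
Qed.
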